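(* Let $p\in\mathbb H\setminus\mathbb R$ and let $\{a_n\}_{n\in\mathbb N_0}\subseteq\mathbb H$ be a given sequence. Put $c_n:=2^n\,n!\,(-1)^n$ and define $\{b_n\}_{n\in\mathbb N_0}\subseteq\mathbb H$ by $$b_0=c_0a_0,\qquad b_n=c_na_{2n}+c_{n-1}a_{2n-1}\quad(n\ge1).$$ Then for every $N\in\mathbb N_0$ and every $q\in\mathbb H$ $$\sum_{n=0}^N(q-p)^{*n}b_n=\sum_{n=0}^NV_p^n\big(Q_p^n(q)\big)a_{2n}+\sum_{n=0}^{N-1}V_p^n\big(Q_p^n(q)(q-p)\big)a_{2n+1},$$ where the last sum is empty for $N=0$.
   Context: $\mathbb H$ denotes the quaternions, $p=p_0+\underline p$ with $\underline p=p_1e_1+p_2e_2+p_3e_3$ (here $p_\ell$ are the real components), $|\cdot|$ the Euclidean norm, $\mathbb N_0=\{0,1,2,\dots\}$. $Q_p^n(q)=(q^2-2p_0q+|p|^2)^n$. $(q-p)^{*n}$ is the $n$-th power of $q-p$ for the left $*$-product in $q$, i.e. $(q-p)^{*n}=\sum_{k=0}^n\binom nk q^k(-p)^{n-k}$. $V_p$ is the right global operator, acting on $C^1$ quaternion-valued functions of $p\in\mathbb H\setminus\mathbb R$ (with $q$ held fixed) by $$V_p(F)=\frac{\partial F}{\partial p_0}+\Big(\sum_{\ell=1}^3p_\ell\frac{\partial F}{\partial p_\ell}\Big)\frac{\underline p}{|\underline p|^2},$$ where $\underline p/|\underline p|^2$ multiplies on the right; $V_p^n$ is its $n$-fold iterate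 and $V_p^0$ the identity. *)

(* Defs.v *)
From HB Require Import structures.
From mathcomp Require Import all_boot all_order all_algebra.
From mathcomp Require Import all_classical all_reals all_analysis.
From mathcomp Require Import ring.

Set Implicit Arguments.
Unset Strict Implicit.
Unset Printing Implicit Defensive.

Import Order.TTheory GRing.Theory Num.Theory.
Import numFieldNormedType.Exports.

Local Open Scope classical_set_scope.
Local Open Scope ring_scope.

(* The quaternion p0 + p1 e1 + p2 e2 + p3 e3 is the row vector (p0, p1, p2, p3),
   whose l-th component is [p 0 l].  The norm [`|p|] inherited from 'rV[R]_4 is
   the sup norm: it induces the usual topology, hence the usual derivatives, but
   the Euclidean norm is [qabs] below. *)
Definition quat (R : realType) : Type := 'rV[R]_4.

HB.instance Definition _ (R : realType) := NormedModule.copy (quat R) 'rV[R]_4.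

Section quaternion_algebra.
Variable R : realType.
Implicit Types p q : quat R.

Definition mkquat (x0 x1 x2 x3 : R) : quat R :=
  \row_(l < 4) nth 0 [:: x0; x1; x2; x3] l.

Definition qone : quat R := mkquat 1 0 0 0.

Definition qmul p q : quat R :=
  let p0 := p 0 (inord 0) in let p1 := p 0 (inord 1) in
  let p2 := p 0 (inord 2) in let p3 := p 0 (inord 3) in
  let q0 := q 0 (inord 0) in let q1 := q 0 (inord 1) in
  let q2 := q 0 (inord 2) in let q3 := q 0 (inord 3) in
  mkquat (p0 * q0 - p1 * q1 - p2 * q2 - p3 * q3)
         (p0 * q1 + p1 * q0 + p2 * q3 - p3 * q2)
         (p0 * q2 - p1 * q3 + p2 * q0 + p3 * q1)
         (p0 * q3 + p1 * q2 - p2 * q1 + p3 * q0).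

Lemma mkquatE x0 x1 x2 x3 :
  ((mkquat x0 x1 x2 x3 0 (inord 0) = x0) * (mkquat x0 x1 x2 x3 0 (inord 1) = x1)
  * (mkquat x0 x1 x2 x3 0 (inord 2) = x2)
  * (mkquat x0 x1 x2 x3 0 (inord 3) = x3))%type.
Proof. by rewrite !mxE !inordK. Qed.

Lemma quatP p q :
  p 0 (inord 0) = q 0 (inord 0) -> p 0 (inord 1) = q 0 (inord 1) ->
  p 0 (inord 2) = q 0 (inord 2) -> p 0 (inord 3) = q 0 (inord 3) -> p = q.
Proof.
move=> h0 h1 h2 h3; apply/rowP => l; rewrite -(inord_val l).
by case: l => -[|[|[|[|//]]]].
Qed.

Lemma quatDE p q (l : 'I_4) : (p + q : quat R) 0 l = p 0 l + q 0 l.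
Proof. exact: mxE. Qed.

Lemma quatZE (a : R) p (l : 'I_4) : (a *: p : quat R) 0 l = a * p 0 l.
Proof. exact: mxE. Qed.

Lemma qmulA : associative qmul.
Proof. by move=> p q r; apply: quatP; rewrite !mkquatE; ring. Qed.

Lemma qmul1q : left_id qone qmul.
Proof. by move=> p; apply: quatP; rewrite !mkquatE; ring. Qed.

Lemma qmulq1 : right_id qone qmul.
Proof. by move=> p; apply: quatP; rewrite !mkquatE; ring. Qed.

Lemma qmulDl : left_distributive qmul +%R.
Proof. by move=> p q r; apply: quatP; rewrite !(quatDE, mkquatE); ring. Qed.

Lemma qmulDr : right_distributive qmul +%R.
Proof. by move=> p q r; apply: quatP; rewrite !(quatDE, mkquatE); ring. Qed.

Lemma qone_neq0 : qone != 0.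
Proof.
apply/eqP => /(congr1 (fun p : quat R => p 0 (inord 0))).
by rewrite mkquatE mxE => /eqP; rewrite oner_eq0.
Qed.

HB.instance Definition _ := GRing.Zmodule_isNzRing.Build (quat R)
  qmulA qmul1q qmulq1 qmulDl qmulDr qone_neq0.

Lemma qscaleAl (a : R) p q : a *: (p * q) = (a *: p) * q.
Proof. by apply: quatP; rewrite !(quatZE, mkquatE); ring. Qed.

HB.instance Definition _ := GRing.Lmodule_isLalgebra.Build R (quat R) qscaleAl.

Lemma qscaleAr (a : R) p q : a *: (p * q) = p * (a *: q).
Proof. by apply: quatP; rewrite !(quatZE, mkquatE); ring. Qed.

HB.instance Definition _ := GRing.Lalgebra_isAlgebra.Build R (quat R) qscaleAr.

(* The real basis 1, e1, e2, e3. *)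
Definition qbase (l : 'I_4) : quat R := delta_mx 0 l.

Definition qre p : R := p 0 ord0.

Definition qvec p : quat R := \sum_(l < 4 | l != ord0) p 0 l *: qbase l.

Definition qabs p : R := Num.sqrt (\sum_(l < 4) p 0 l ^+ 2).

Definition qreal : set (quat R) := [set x%:A | x in [set: R]].

End quaternion_algebra.

Section theorem_objects.
Variable R : realType.
Implicit Types p q : quat R.

Definition Qpow (n : nat) p q : quat R :=
  (q ^+ 2 - (2 * qre p) *: q + (qabs p ^+ 2)%:A) ^+ n.

(* The left *-product of the functions sum_k q^k f_k and sum_k q^k g_k of q
   is sum_n q^n (sum_k f_k g_(n-k)), i.e. the product of [f * g] in
   {poly quat R}, where 'X commutes with the coefficients.  The library's
   [f.[q]] puts the coefficients on the left of the powers, whence [seval]. *)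
Definition seval (f : {poly quat R}) q : quat R :=
  \sum_(k < size f) q ^+ k * f`_k.

Definition starpow (n : nat) p q : quat R := seval (('X - p%:P) ^+ n) q.

Lemma starpowE n p q :
  starpow n p q = \sum_(k < n.+1) (q ^+ k * (- p) ^+ (n - k)) *+ 'C(n, k).
Proof.
have -> : starpow n p q = \sum_(k < n.+1) q ^+ k * (('X - p%:P) ^+ n)`_k.
  by rewrite /starpow /seval size_exp_XsubC.
apply: eq_bigr => k _.
have cXp : GRing.comm (- p%:P) 'X :> Prop by exact: commr_polyX.
rewrite addrC (exprDn_comm _ cXp) coef_sum (bigD1 k) //= big1 ?addr0.
  by rewrite coefMn -polyCN -polyC_exp coefCM coefXn eqxx mulr1 mulrnAr.
move=> i ik; rewrite coefMn -polyCN -polyC_exp coefCM coefXn.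
by rewrite eq_sym (negbTE ik : ((i : nat) == k) = false) mulr0 mul0rn.
Qed.

(* Right global operator; the value of [Vop F] is only meaningful off [qreal]
   (an open set, so that iterating it there never involves points of
   [qreal]). *)
Definition Vop (F : quat R -> quat R) p : quat R :=
  'D_(qbase R ord0) F p
  + (\sum_(l < 4 | l != ord0) p 0 l *: 'D_(qbase R l) F p)
    * ((qabs (qvec p) ^+ 2)^-1 *: qvec p).

Definition Viter (n : nat) (F : quat R -> quat R) : quat R -> quat R :=
  iter n Vop F.

Definition coefc (n : nat) : R := 2 ^+ n * n`!%:R * (-1) ^+ n.

End theorem_objects.

(* Main.v *)
(* Off the real axis V vanishes on p, takes the value 2 on conj p, and obeys
   the Leibniz rule against p and conj p on the right: V is twice the
   derivative in conj p.  As Q_p(q) is the *-product of q - p and q - conj p,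
   V^n turns the *-product of (q - p)^{*m} and (q - conj p)^{*n} into
   (-2)^n n! (q - p)^{*m}; the cases m = n and m = n + 1 give the two sums. *)
Require Import Defs.
From HB Require Import structures.
From mathcomp Require Import all_boot all_order all_algebra.
From mathcomp Require Import all_classical all_reals all_analysis.
From mathcomp Require Import ring.
Import Order.TTheory GRing.Theory Num.Theory.
Import numFieldNormedType.Exports.
Local Open Scope ring_scope.

(** * Product rule for directional derivatives of quaternion-valued functions *)

Section product_rule.
Variable R : realType.
Implicit Types (p v : quat R) (f g : quat R -> quat R).
Local Open Scope classical_set_scope.

Lemma quat_sum_base p : p = \sum_(l < 4) p 0 l *: qbase R l.
Proof. exact: row_sum_delta. Qed.

Lemma quat_mul_base p q :
  p * q = \sum_(l < 4) \sum_(m < 4) (p 0 l * q 0 m) *: (qbase R l * qbase R m).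
Proof.
rewrite {1}(quat_sum_base p) mulr_suml; apply: eq_bigr => l _.
rewrite {1}(quat_sum_base q) mulr_sumr; apply: eq_bigr => m _.
by rewrite -scalerAl -scalerAr scalerA.
Qed.

(** Bilinearity reduces the limit to finitely many products of real coordinates. *)
Lemma cvg_quatM (T : Type) (F : set_system T) (FF : Filter F)
    (f g : T -> quat R) (a b : quat R) :
  f @ F --> a -> g @ F --> b -> (fun t => f t * g t) @ F --> a * b.
Proof.
move=> fa gb; rewrite quat_mul_base.
under eq_fun do rewrite quat_mul_base.
apply: cvg_big => [|l _]; first exact: add_continuous.
apply: cvg_big => [|m _]; first exact: add_continuous.
apply: cvgZr_tmp; apply: cvgM.
- exact: (@cvg_comp _ _ _ f (fun x : quat R => x 0 l)
    _ _ _ fa (@coord_continuous R 1 4 0 l a)).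
- exact: (@cvg_comp _ _ _ g (fun x : quat R => x 0 m)
    _ _ _ gb (@coord_continuous R 1 4 0 m b)).
Qed.

(** On the line through [p], [f] is a derivable function of one real variable, hence continuous at
    0. *)
Lemma derivable_cvg_line f p v :
  derivable f p v -> f (h *: v + p) @[h --> (0 : R)^'] --> f p.
Proof.
move=> /derivable1P/derivable1_diffP/differentiable_continuous.
move=> /continuous_withinNx; rewrite /= scale0r add0r; exact.
Qed.

Lemma is_derive_quatM f g p v (df dg : quat R) :
  is_derive p v f df -> is_derive p v g dg ->
  is_derive p v (fun x => f x * g x) (df * g p + f p * dg).
Proof.
move=> [fd <-] [gd <-].
suff H : (fun h => h^-1 *:
    (((fun x => f x * g x) \o shift p) (h *: v) - f p * g p))
    @ (0 : R)^' --> 'D_v f p * g p + f p * 'D_v g p.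
  by apply: DeriveDef; [apply: cvgP H | exact: (cvg_lim _ H)].
(* Inserting [f p * g (h *: v + p)] splits the difference quotient and keeps the order of the
   factors. *)
have -> : (fun h => h^-1 *:
    (((fun x => f x * g x) \o shift p) (h *: v) - f p * g p))
   = (fun h => (h^-1 *: ((f \o shift p) (h *: v) - f p)) * g (h *: v + p)
       + f p * (h^-1 *: ((g \o shift p) (h *: v) - g p))).
  apply/funext => h /=; rewrite -scalerAl -scalerAr -scalerDr mulrBl mulrBr.
  by congr (_ *: _); rewrite addrA subrK.
apply: cvgD; apply: cvg_quatM.
- exact: fd.
- exact: derivable_cvg_line.
- exact: cvg_cst.
- exact: gd.
Qed.

Lemma is_derive_linear f p v : linear f -> is_derive p v f (f v).
Proof.
move=> fL.
suff H : (fun h => h^-1 *: ((f \o shift p) (h *: v) - f p)) @ (0 : R)^' --> f v.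
  by apply: DeriveDef; [apply: cvgP H | exact: (cvg_lim _ H)].
(* By linearity the quotient is exactly [f v] for every [h != 0]. *)
apply: (@cvg_trans _ (cst (f v) @ (0 : R)^')); last exact: cvg_cst.
apply: near_eq_cvg.
near=> h; rewrite /= fL addrK scalerA mulVf ?scale1r //.
by near: h; exact: nbhs_dnbhs_neq.
Unshelve. all: by end_near. Qed.

End product_rule.

(** * Conjugation, and the direction by which V multiplies on the right *)

Section conjugate.
Variable R : realType.
Implicit Types (p v : quat R).

(** In this form [p + qconj p] is visibly real, and whatever commutes with [p] commutes with
    [qconj p]. *)
Definition qconj p : quat R := (2 * qre p)%:A - p.

Lemma qconj_is_linear : linear qconj.
Proof.
move=> a x y; rewrite /qconj /qre quatDE quatZE.
by apply: quatP; rewrite !mxE; ring.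
Qed.

(** The right factor in [Vop]; off the real axis it is the inverse of [- qvec p]. *)
Definition qdir p : quat R := (qabs (qvec p) ^+ 2)^-1 *: qvec p.

Lemma qreE p : qre p = p 0 (inord 0).
Proof. by congr (p _ _); apply/val_inj; rewrite /= inordK. Qed.

Lemma qvec_coord p l : qvec p 0 l = if l == ord0 then 0 else p 0 l.
Proof.
have : p = qre p *: qbase R ord0 + qvec p.
  by rewrite {1}(quat_sum_base R p) (bigD1 ord0).
move=> /(congr1 (fun x : quat R => x 0 l)); rewrite quatDE quatZE.
rewrite /qbase mxE eqxx /=; case: eqVneq => [->|_] e.
  by apply: (addrI (p 0 ord0)); rewrite addr0 [RHS]e mulr1.
by rewrite [RHS]e mulr0 add0r.
Qed.

Lemma qvecE p :
  qvec p = mkquat 0 (p 0 (inord 1)) (p 0 (inord 2)) (p 0 (inord 3)).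
Proof.
by apply: quatP; rewrite mkquatE qvec_coord -val_eqE /= inordK.
Qed.

Lemma qabs2 p : qabs p ^+ 2 = p 0 (inord 0) ^+ 2 + p 0 (inord 1) ^+ 2
  + p 0 (inord 2) ^+ 2 + p 0 (inord 3) ^+ 2.
Proof.
rewrite sqr_sqrtr ?sumr_ge0// => [|i _]; last exact: sqr_ge0.
rewrite !big_ord_recr big_ord0 /= add0r.
by do 3?[congr (_ + _)]; congr (p _ _ ^+ 2); apply/val_inj; rewrite /= inordK.
Qed.

Lemma qone_coord : (1 : quat R) = mkquat 1 0 0 0. Proof. by []. Qed.

Lemma qbase0 : qbase R ord0 = 1.
Proof.
by apply: quatP; rewrite mkquatE /qbase mxE eqxx -val_eqE /= inordK.
Qed.

Lemma quatNE p l : (- p : quat R) 0 l = - p 0 l. Proof. exact: mxE. Qed.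

Lemma mulqE p q : p * q = qmul p q. Proof. by []. Qed.

(** Reduces a quaternion identity to real coordinates, where [ring] settles it. *)
Definition quatE :=
  (quatDE, quatZE, quatNE, mulqE, mkquatE, qone_coord, qreE, qvecE, qabs2).

Lemma qvec_neq0 p : ~ qreal p -> qvec p != 0.
Proof.
move=> hp; apply/eqP => v0; apply: hp; exists (p 0 (inord 0)) => //.
have E k : qvec p 0 (inord k) = 0 by rewrite v0 mxE.
move: (E 1%N) (E 2%N) (E 3%N); rewrite qvecE !mkquatE => e1 e2 e3.
by apply: quatP; rewrite !quatE ?e1 ?e2 ?e3; ring.
Qed.

(** An imaginary quaternion squares to minus its squared norm, which is nonzero off the real
    axis. *)
Lemma mul_qvec_dir p : ~ qreal p -> qvec p * qdir p = -1.
Proof.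
move=> hp; rewrite /qdir -scalerAr.
have -> : qvec p * qvec p = - (qabs (qvec p) ^+ 2)%:A.
  by apply: quatP; rewrite !quatE; ring.
rewrite scalerN scalerA mulVf ?scale1r//; apply/eqP => e.
move: (qvec_neq0 _ hp); case/eqP; move: e; rewrite qabs2.
rewrite !qvecE !mkquatE expr0n add0r => /eqP.
rewrite !paddr_eq0 ?addr_ge0 ?sqr_ge0// !sqrf_eq0.
move=> /andP[/andP[/eqP-> /eqP->] /eqP->].
by apply: quatP; rewrite mkquatE mxE.
Qed.

(** Both factors are real combinations of 1 and [qvec p]. *)
Lemma mul_dirC p : p * qdir p = qdir p * p.
Proof.
rewrite /qdir -scalerAl -scalerAr; congr (_ *: _).
by apply: quatP; rewrite !quatE; ring.
Qed.

Lemma mul_conj_dirC p : qconj p * qdir p = qdir p * qconj p.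
Proof. by rewrite /qconj mulrBl mulrBr mul_dirC mulr_algl mulr_algr. Qed.

Lemma qconj1 : qconj 1 = 1.
Proof. by rewrite /qconj; apply: quatP; rewrite !quatE; ring. Qed.

Lemma qconj_vec p : qconj (qvec p) = - qvec p.
Proof. by rewrite /qconj; apply: quatP; rewrite !quatE; ring. Qed.

Lemma conjqC p : qconj p * p = p * qconj p.
Proof. by rewrite /qconj; apply: quatP; rewrite !quatE; ring. Qed.

Lemma conjqM p : qconj p * p = (qabs p ^+ 2)%:A.
Proof. by rewrite /qconj; apply: quatP; rewrite !quatE; ring. Qed.

End conjugate.

(** * Locality, linearity and Leibniz rule of V *)

Section global_operator.
Variable R : realType.
Implicit Types (p q x y c : quat R) (F G L : quat R -> quat R).

(** Some imaginary coordinate is nonzero at [p], and stays so nearby by continuity. *)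
Lemma near_nonreal p : ~ qreal p -> \forall x \near p, ~ qreal x.
Proof.
move=> hp.
have [l l0 pl] : exists2 l, l != ord0 & p 0 l != 0.
  apply: contrapT => H; move/eqP: (qvec_neq0 _ _ hp); apply.
  apply/rowP => l; rewrite qvec_coord mxE; case: eqVneq => // l0.
  by apply: contrapT => /eqP pl; apply: H; exists l.
have nl : \forall x \near p, (x : quat R) 0 l != 0.
  exact: (@cvgr_neq0 R R^o _ (nbhs p) _ (fun x : quat R => x 0 l) (p 0 l)
    (@coord_continuous R 1 4 0 l p) pl).
apply: filterS nl => x /[swap] -[r _ <-].
by rewrite quatZE -qbase0 /qbase mxE eqxx (negbTE l0) mulr0 eqxx.
Qed.

(** [F] and [G] agree on a neighbourhood of [p], so their derivatives there coincide. This lets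
    formulas valid only off the real axis be iterated. *)
Lemma eq_Vop F G : (forall x, ~ qreal x -> F x = G x) ->
  forall p, ~ qreal p -> Vop F p = Vop G p.
Proof.
move=> FG p hp.
have E v : 'D_v F p = 'D_v G p.
  apply: near_eq_derive; apply: filterS (near_nonreal p hp); exact: FG.
rewrite /Vop E; apply: congr1; apply: (congr1 (fun z => z * _)).
by apply: eq_bigr => l _; rewrite E.
Qed.

Lemma eq_Viter n F G : (forall x, ~ qreal x -> F x = G x) ->
  forall p, ~ qreal p -> Viter n F p = Viter n G p.
Proof.
by move=> FG; elim: n => [|n IH]; [exact: FG | exact: eq_Vop IH].
Qed.

Definition diffable F := forall p v, derivable F p v.

Lemma diffable_cst c : diffable (cst c).
Proof. by move=> p v; exact: derivable_cst. Qed.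

Lemma diffableM F G : diffable F -> diffable G -> diffable (fun x => F x * G x).
Proof.
by move=> dF dG p v; have [] := is_derive_quatM R F G p v _ _
  (derivableP (dF p v)) (derivableP (dG p v)).
Qed.

Lemma VopE F p : Vop F p = 'D_(qbase R ord0) F p
  + (\sum_(l < 4 | l != ord0) p 0 l *: 'D_(qbase R l) F p) * qdir R p.
Proof. by []. Qed.

(** A linear map is its own derivative, so the imaginary partial derivatives recombine into
    [L (qvec p)]. *)
Lemma Vop_linear L p : linear L -> Vop L p = L 1 + L (qvec p) * qdir R p.
Proof.
move=> lL; have D v : 'D_v L p = L v.
  by have [] := is_derive_linear R L p v lL.
have L0 : L 0 = 0.
  by move: (lL (-1) 0 0); rewrite scaler0 addr0 scaleN1r addNr.
have Ls k x : L (k *: x) = k *: L x.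
  by move: (lL k x 0); rewrite !addr0 L0 addr0.
have LD x y : L (x + y) = L x + L y by move: (lL 1 x y); rewrite !scale1r.
rewrite VopE D qbase0; congr (_ + _ * _).
rewrite /qvec (big_morph L LD L0); apply: eq_bigr => l _.
by rewrite D Ls.
Qed.

(** Constants on the left pass through V because [qdir] multiplies on the right. *)
Lemma VopMl q F p : diffable F -> Vop (fun x => q * F x) p = q * Vop F p.
Proof.
move=> dF; have D v : 'D_v (fun x => q * F x) p = q * 'D_v F p.
  have [_ ->] := is_derive_quatM R (cst q) F p v _ _
    (is_derive_cst q p v) (derivableP (dF p v)).
  by rewrite mul0r add0r.
rewrite !VopE D; under eq_bigr do rewrite D scalerAr.
by rewrite -mulr_sumr mulrDr mulrA.
Qed.

Lemma VopB F G p : diffable F -> diffable G ->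
  Vop (fun x => F x - G x) p = Vop F p - Vop G p.
Proof.
move=> dF dG; have D v : 'D_v (fun x => F x - G x) p = 'D_v F p - 'D_v G p.
  exact: (deriveB (dF p v) (dG p v)).
rewrite !VopE D; under eq_bigr do rewrite D scalerBr.
by rewrite sumrB mulrBl opprD addrACA.
Qed.

Lemma VopZ a F p : diffable F -> Vop (fun x => a *: F x) p = a *: Vop F p.
Proof.
move=> dF; have D v : 'D_v (fun x => a *: F x) p = a *: 'D_v F p.
  exact: (deriveZ _ (dF p v)).
rewrite !VopE D; under eq_bigr do rewrite D scalerA mulrC -scalerA.
by rewrite -scaler_sumr -scalerAl -scalerDr.
Qed.

Lemma Vop_cst c p : Vop (cst c) p = 0.
Proof.
have D v : 'D_v (cst c) p = 0 by exact: derive_cst.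
by rewrite VopE D add0r big1 ?mul0r // => l _; rewrite D scaler0.
Qed.

(* The commutation hypothesis lets the right factor qdir of V pass G. *)
Lemma VopM F G p : diffable F -> diffable G ->
  G p * qdir R p = qdir R p * G p ->
  Vop (fun x => F x * G x) p = Vop F p * G p + F p * Vop G p.
Proof.
move=> dF dG GC.
have D v : 'D_v (fun x => F x * G x) p = 'D_v F p * G p + F p * 'D_v G p.
  by have [] := is_derive_quatM R F G p v _ _
    (derivableP (dF p v)) (derivableP (dG p v)).
rewrite !VopE D; under eq_bigr do rewrite D scalerDr scalerAl scalerAr.
rewrite big_split /= -mulr_suml -mulr_sumr !mulrDl mulrDr !mulrA.
by rewrite -(mulrA _ (G p)) GC !mulrA addrACA.
Qed.

(** * Action of V on [p], on its conjugate and on star-products of linear factors *)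

Lemma diffable_linear L : linear L -> diffable L.
Proof. by move=> lL p v; have [] := is_derive_linear R L p v lL. Qed.

Lemma id_is_linear : linear (fun x : quat R => x). Proof. by []. Qed.

Lemma Vop_id p : ~ qreal p -> Vop (fun x => x) p = 0.
Proof.
by move=> hp; rewrite (Vop_linear _ _ id_is_linear) mul_qvec_dir // subrr.
Qed.

Lemma Vop_conj p : ~ qreal p -> Vop (qconj R) p = 2%:A.
Proof.
move=> hp; rewrite (Vop_linear _ _ (qconj_is_linear R)) qconj1 qconj_vec.
by rewrite mulNr mul_qvec_dir // opprK scaler_nat.
Qed.

(* Left *-multiplication by q - c: with the coefficients on the right of the
   powers of q, q multiplies on the left and c on the right. *)
Definition starmul q c y := q * y - y * c.

Lemma starmulZ a q c y : starmul q c (a *: y) = a *: starmul q c y.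
Proof. by rewrite /starmul -scalerAr -scalerAl scalerBr. Qed.

(** Left multiplications by [q] commute with right ones, so only the order of [c] and [d]
    matters. *)
Lemma starmulC q c d y : c * d = d * c ->
  starmul q c (starmul q d y) = starmul q d (starmul q c y).
Proof.
move=> cd; rewrite /starmul !mulrBr !mulrBl !mulrA -!(mulrA y) cd.
by rewrite !opprB !addrA addrAC [RHS]addrAC [X in X + _ = _]addrAC.
Qed.

Lemma diffable_starmul q F G : diffable F -> diffable G ->
  diffable (fun x => starmul q (G x) (F x)).
Proof.
move=> dF dG p v; apply: derivableB.
- exact: (diffableM (cst q) F (diffable_cst q) dF p v).
- exact: (diffableM F G dF dG p v).
Qed.

Lemma Vop_starmul q F G p : diffable F -> diffable G ->
  G p * qdir R p = qdir R p * G p ->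
  Vop (fun x => starmul q (G x) (F x)) p
  = starmul q (G p) (Vop F p) - F p * Vop G p.
Proof.
move=> dF dG GC; rewrite /starmul VopB.
- by rewrite (VopMl _ _ _ dF) (VopM _ _ _ dF dG GC) opprD addrA.
- exact: (diffableM (cst q) F (diffable_cst q) dF).
- exact: (diffableM F G dF dG).
Qed.

(* The value at q of the *-product of (q - p)^{*m} and (q - conj p)^{*n}. *)
Definition starprod q m n p :=
  iter m (starmul q p) (iter n (starmul q (qconj R p)) 1).

Lemma diffable_starprod q m n : diffable (starprod q m n).
Proof.
elim: m => [|m IH] /=.
  elim: n => [|n IH] /=; first exact: diffable_cst.
  by apply: diffable_starmul IH (diffable_linear _ (qconj_is_linear R)).
by apply: diffable_starmul IH (diffable_linear _ id_is_linear).
Qed.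

(** V passes the factors [q - p] and draws -2 from each of the [n] factors [q - conj p]. At [n = 0]
    the scalar vanishes, so the value of [n.-1] is harmless. *)
Lemma Vop_starprod q m n p : ~ qreal p ->
  Vop (starprod q m n) p = - 2 * n%:R *: starprod q m n.-1 p.
Proof.
move=> hp; elim: m => [|m IH]; last first.
  rewrite (Vop_starmul q _ _ _ (diffable_starprod q m n)
    (diffable_linear _ id_is_linear) (mul_dirC R p)).
  by rewrite (Vop_id _ hp) mulr0 subr0 IH starmulZ.
elim: n => [|n IH]; first by rewrite mulr0 scale0r; exact: Vop_cst.
rewrite (Vop_starmul q _ _ _ (diffable_starprod q 0 n)
  (diffable_linear _ (qconj_is_linear R)) (mul_conj_dirC R p)).
rewrite (Vop_conj _ hp) IH starmulZ mulr_algr.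
(* The outer factor restores the one removed by [n.-1]; for [n = 0] both sides vanish. *)
have -> : - 2 * n%:R *: starmul q (qconj R p) (starprod q 0 n.-1 p)
    = - 2 * n%:R *: starprod q 0 n p.
  by case: n {IH} => [|n]; [rewrite mulr0 !scale0r|].
by rewrite -scalerBl -(natr1 n) mulrDr mulr1.
Qed.

(** The scalar [a] accumulates the factors [-2 k], whose product over [k] from 1 to [n] is
    [coefc R n]. *)
Lemma Viter_scale_starprod a q m n p : ~ qreal p ->
  Viter n (fun x => a *: starprod q m n x) p
  = (a * coefc R n) *: starprod q m 0 p.
Proof.
elim: n a p => [|n IH] a p hp.
  by rewrite /coefc expr0 fact0 !mulr1.
(* The innermost V is evaluated first; its value is known off the real axis only, hence
   [eq_Viter]. *)
rewrite /Viter iterSr -/(Viter n _).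
rewrite (eq_Viter n _
  (fun x => (a * (- 2 * n.+1%:R)) *: starprod q m n x) _ p hp).
  rewrite (IH _ _ hp); congr (_ *: _); rewrite /coefc factS natrM !exprS.
  by ring.
move=> x hx; rewrite (VopZ _ _ _ (diffable_starprod q m n.+1)).
by rewrite (Vop_starprod _ _ _ _ hx) scalerA.
Qed.

Lemma Viter_starprod q m n p : ~ qreal p ->
  Viter n (starprod q m n) p = coefc R n *: starprod q m 0 p.
Proof.
move=> hp; rewrite -[coefc R n]mul1r -(Viter_scale_starprod _ _ _ _ _ hp).
by apply: (eq_Viter _ _ _ _ _ hp) => x _; rewrite scale1r.
Qed.

(** As [conj p] commutes with [p], the new factor slides under the [m] outer ones. *)
Lemma starmul_starprod q m n p :
  starmul q (qconj R p) (starprod q m n p) = starprod q m n.+1 p.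
Proof.
elim: m => [|m IH] //.
rewrite -[starprod q m.+1 n.+1 p]/(starmul q p (starprod q m n.+1 p)).
by rewrite -IH starmulC ?conjqC.
Qed.

(** * Powers of Q and star-powers as star-products *)

(** The coefficients [p + conj p] and [conj p * p] of Q are real, so they may move to the right of
    [y], where star-multiplication puts them. *)
Lemma Qpow1M p q y : Qpow 1 p q * y = starmul q p (starmul q (qconj R p) y).
Proof.
rewrite /Qpow expr1 -conjqM /starmul.
have -> : (2 * qre p) *: q = q * (p + qconj R p).
  by rewrite /qconj addrC subrK mulr_algr.
have abs_comm : y * (qconj R p * p) = qconj R p * p * y.
  by rewrite conjqM mulr_algl mulr_algr.
have re_comm : y * (p + qconj R p) = (p + qconj R p) * y.
  by rewrite /qconj addrC subrK mulr_algl mulr_algr.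
(* From here only distributivity and the two commutations are used, with [conj p] opaque. *)
move: (qconj R p) abs_comm re_comm => c abs_comm re_comm.
rewrite !mulrDl mulNr -[q * (_ + _) * y]mulrA.
rewrite -[(p + c) * y]re_comm -[c * p * y]abs_comm.
rewrite expr2 !mulrBr mulNr !mulrDr -!mulrA opprD opprB.
by rewrite !addrA [RHS]addrAC [X in X + _ = _]addrAC.
Qed.

Lemma QpowM_starprod q m n k p :
  Qpow n p q * starprod q m k p = starprod q (n + m) (n + k) p.
Proof.
elim: n => [|n IH]; first by rewrite /Qpow expr0 mul1r.
have -> : Qpow n.+1 p q = Qpow 1 p q * Qpow n p q by rewrite /Qpow exprS expr1.
by rewrite -mulrA IH Qpow1M starmul_starprod.
Qed.

(** Allows a common summation range when only a bound on the size is known. *)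
Lemma seval_widen (f : {poly quat R}) q n : (size f <= n)%N ->
  seval f q = \sum_(k < n) q ^+ k * f`_k.
Proof.
move=> fn; rewrite /seval (big_ord_widen n (fun k => q ^+ k * f`_k) fn).
rewrite big_mkcond; apply: eq_bigr => k _; case: ltnP => // fk.
by rewrite nth_default ?mulr0.
Qed.

Lemma seval_mulXsubC (f : {poly quat R}) q c :
  seval (f * ('X - c%:P)) q = starmul q c (seval f q).
Proof.
have sf : (size (f * ('X - c%:P))%R <= (size f).+1)%N.
  by apply: leq_trans (size_polyMleq _ _) _; rewrite size_XsubC addn2.
rewrite (seval_widen _ _ _ sf) /starmul.
under eq_bigr do rewrite mulrBr coefB coefMC mulrBr mulrA.
rewrite sumrB -mulr_suml -(seval_widen _ _ _ (leqnSn _)); congr (_ - _).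
(* [f * 'X] has constant coefficient 0; shifting the index then releases one [q] on the left. *)
rewrite big_ord_recl coefMX mulr0 add0r /seval mulr_sumr.
by apply: eq_bigr => k _; rewrite coefMX /= exprS mulrA.
Qed.

Lemma starpow_starprod n p q : starpow n p q = starprod q n 0 p.
Proof.
rewrite /starpow; elim: n => [|n IH].
  by rewrite expr0 /seval size_poly1 big_ord1 expr0 coef1 mul1r.
by rewrite exprSr seval_mulXsubC IH.
Qed.

Lemma Viter_Qpow n p q : ~ qreal p ->
  Viter n (fun x => Qpow n x q) p = coefc R n *: starpow n p q.
Proof.
move=> hp; rewrite starpow_starprod -(Viter_starprod _ _ _ _ hp).
apply: (eq_Viter _ _ _ _ _ hp) => x _.
by rewrite -[LHS]mulr1 (QpowM_starprod q 0 n 0 x) !addn0.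
Qed.

Lemma Viter_Qpow_mul n p q : ~ qreal p ->
  Viter n (fun x => Qpow n x q * (q - x)) p = coefc R n *: starpow n.+1 p q.
Proof.
move=> hp; rewrite starpow_starprod -(Viter_starprod _ _ _ _ hp).
apply: (eq_Viter _ _ _ _ _ hp) => x _.
have -> : q - x = starprod q 1 0 x.
  by rewrite /starprod /= /starmul mulr1 mul1r.
by rewrite QpowM_starprod addn1 addn0.
Qed.

End global_operator.

Theorem theorem3p6 (R : realType) (p : quat R) (hp : ~ qreal p)
    (a b : nat -> quat R)
    (hb0 : b 0%N = coefc R 0 *: a 0%N)
    (hb : forall n : nat, (1 <= n)%N ->
       b n = coefc R n *: a (2 * n)%N + coefc R (n - 1) *: a (2 * n - 1)%N)
    (N : nat) (q : quat R) :
  \sum_(0 <= n < N.+1) starpow n p q * b n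
  = \sum_(0 <= n < N.+1) Viter n (fun x : quat R => Qpow n x q) p * a (2 * n)%N
    + \sum_(0 <= n < N)
        Viter n (fun x : quat R => Qpow n x q * (q - x)) p * a (2 * n + 1)%N.
Proof.
under [X in _ = X + _]eq_bigr do rewrite (Viter_Qpow _ _ _ _ hp).
under [X in _ = _ + X]eq_bigr do rewrite (Viter_Qpow_mul _ _ _ _ hp).
(* With the terms at 0 split off, [b n.+1] pairs the even term of index [n.+1] with the odd term of
   index [n]. *)
rewrite [LHS]big_nat_recl // [X in _ = X + _]big_nat_recl //.
rewrite hb0 muln0 -scalerAl scalerAr -addrA -big_split /=; congr (_ + _).
apply: eq_bigr => n _.
rewrite hb // mulrDr -!scalerAr -!scalerAl subn1 /=.
have -> : (2 * n.+1 - 1 = 2 * n + 1)%N by rewrite mulnS addSn subn1 addnC addn1.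
by [].
Qed.
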